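(* Let $\mathcal{A}$ be a finite alphabet and let $S\subset\mathcal{A}^{<\mathbb{N}}$ be a uniformly recurrent tree set containing $\mathcal{A}$. Fix a strategy $s_1$ of Player 1 in the full tree $\mathcal{A}^{<\mathbb{N}}$, and let $T$ be the tree consisting of all prefixes of the positions in $$Z_{s_1}(S)=\bigl\{\langle a_1,c_1,\dots,a_n,c_n\rangle:\ \langle c_1,\dots,c_n\rangle\in S,\ a_i=s_1(\langle a_1,c_1,\dots,a_{i-1},c_{i-1}\rangle)\ \text{for }1\le i\le n\bigr\}.$$ Let $Z\subset T$ be such that $\hat Z=\{\hat p:p\in Z\}$ is a bifix code, where $\hat p=\langle a_2,a_4,\dots,a_{2\lfloor n/2\rfloor}\rangle$ for $p=\langle a_1,\dots,a_n\rangle$, and let $W=\bigcup_{p\in Z}[T_p]$. Then Player 1 has a winning strategy in the game $(T,W)$ if and only if $\hat Z$ is a basis of a finite index subgroup of the free group $F(\mathcal{A})$. In particular (in that case), $[F(\mathcal{A}):\langle\hat Z\rangle]<\infty$.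
   Context: $\mathcal{A}^{<\mathbb{N}}$ is the set of all finite sequences (words) over $\mathcal{A}$, including the empty one. A tree over $\mathcal{A}$ is a nonempty set $T\subseteq\mathcal{A}^{<\mathbb{N}}$ closed under prefixes and such that each of its elements is a strict prefix of some element of $T$. Its elements are positions; $[T]$ is the set of infinite sequences (plays) all of whose finite prefixes lie in $T$, and $[T_p]$ is the set of plays in $[T]$ having $p$ as a prefix. In the game $(T,W)$ with $W\subseteq[T]$, two players alternately choose actions so that the current position stays in $T$, with Player 1 moving at positions of even length (in particular first) and Player 2 at positions of odd length; Player 1 wins if the resulting play lies in $W$, otherwise Player 2 wins. A strategy of Player 1 assigns to each even-length position a legal action; it is winning if every play consistent with it lies in $W$. A bifix code is a set of words such that no word in it is a prefix of another and no word in it is a suffix of another. $S$ is uniformly recurrent if (a) every subword (contiguous factor) of a word in $S$ belongs to $S$, and (b) for every $w\in S$ there is $N\ge1$ such that every $w'\in S$ with $\mathrm{len}(w')\ge N$ contains $w$ as a subword. In addition every word of $S$ is a strict prefix of some word of $S$ (so that $T$ is a tree). For $w\in S$ let $L(w)=\{a\in\mathcal{A}: aw\in S\}$ and $R(w)=\{b\in\mathcal{A}: wb\in S\}$, and let $G(w)$ be the undirected bipartite graph with vertex set $L(w)\sqcup R(w)$ in which $a\in L(w)$ and $b\in R(w)$ are joined by an edge iff $awb\in S$. $S$ is a tree set if $G(w)$ is a tree for every $w\in S$. A word $\langle b_1,\dots,b_m\rangle$ is identified with the element $b_1\cdots b_m$ of the free group $F(\mathcal{A})$ with basis $\mathcal{A}$;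 $\langle\hat Z\rangle$ is the subgroup generated by $\hat Z$; ''basis'' means free basis.
   Formalization: The words of the bifix code are required to be nonempty; this excludes only the case where the code consists of the empty word alone, for which Player 1 wins trivially but the code is not a basis of a finite index subgroup. *)

(* Defs.v *)
From HB Require Import structures.
From mathcomp Require Import all_boot.
From mathcomp Require Import boolp classical_sets functions cardinality.

Set Implicit Arguments.
Unset Strict Implicit.
Unset Printing Implicit Defensive.

Local Open Scope classical_set_scope.

(* The free group on T: reduced words over the letters (x, true), standing for
   x, and (x, false), standing for the inverse of x. *)
Section FreeGroup.
Variable T : choiceType.
Implicit Types (l : T * bool) (u v w : seq (T * bool)).

Definition invl l := (l.1, ~~ l.2).

Definition reduced w := sorted [rel k l | l != invl k] w.

Record freegroup := FreeGroup { fgword :> seq (T * bool); _ : reduced fgword }.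

HB.instance Definition _ := [isSub for fgword].
HB.instance Definition _ := [Choice of freegroup by <:].

Definition lcons_red l w :=
  if w is k :: w' then if k == invl l then w' else l :: w else [:: l].

Definition mulw u v := foldr lcons_red v u.

Definition invw w := rev (map invl w).

Lemma invlK : involutive invl.
Proof. by case=> x b; rewrite /invl /= negbK. Qed.

Lemma reduced_cons l w :
  reduced (l :: w) = (if w is k :: _ then k != invl l else true) && reduced w.
Proof. by case: w. Qed.

Lemma reduced_lcons_red l w : reduced w -> reduced (lcons_red l w).
Proof.
case: w => [//|k w] rkw /=; case: eqVneq => [_|kl].
  by move: rkw; rewrite reduced_cons => /andP[].
by rewrite reduced_cons kl.
Qed.

Lemma reduced_mulw u v : reduced v -> reduced (mulw u v).
Proof. by move=> rv; elim: u => //= l u IH; apply: reduced_lcons_red. Qed.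

Lemma lcons_redK l w : reduced w -> lcons_red l (lcons_red (invl l) w) = w.
Proof.
case: w => [|k w] rw /=; first by rewrite eqxx.
rewrite invlK; case: (eqVneq k l) rw => [->|kl] rw; last by rewrite /= eqxx.
case: w rw => [//|j w]; rewrite reduced_cons => /andP[jl _] /=.
by rewrite (negbTE jl).
Qed.

Lemma mulw_lcons_red l v w : reduced w ->
  mulw (lcons_red l v) w = lcons_red l (mulw v w).
Proof.
case: v => [//|k v] rw /=; case: eqVneq => [->|//].
by rewrite lcons_redK //; apply: reduced_mulw.
Qed.

Lemma mulwA u v w : reduced w -> mulw (mulw u v) w = mulw u (mulw v w).
Proof. by move=> rw; elim: u => //= l u IH; rewrite mulw_lcons_red // IH. Qed.

Lemma mulw0 w : reduced w -> mulw w [::] = w.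
Proof.
elim: w => // l w IH; rewrite reduced_cons => /andP[wl rw] /=.
by rewrite IH //; case: w wl {IH rw} => //= k w /negbTE->.
Qed.

Lemma reduced_invw w : reduced w -> reduced (invw w).
Proof.
rewrite /reduced /invw -map_rev sorted_map rev_sorted.
by apply: sub_sorted => k l; rewrite /= invlK eq_sym (can2_eq invlK invlK).
Qed.

Lemma mulVw w : mulw (invw w) w = [::].
Proof.
elim: w => // l w IH.
by rewrite /invw /= rev_cons -cats1 /mulw foldr_cat /= invlK eqxx.
Qed.

Lemma invwK : involutive invw.
Proof. by move=> w; rewrite /invw map_rev revK (mapK invlK). Qed.

Definition fg1 : freegroup := @FreeGroup [::] isT.
Definition fgmul (x y : freegroup) :=
  FreeGroup (reduced_mulw (fgword x) (valP y)).
Definition fginv (x : freegroup) := FreeGroup (reduced_invw (valP x)).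

Fact fgmulA : associative fgmul.
Proof. by move=> x y z; apply: val_inj; rewrite /= mulwA //; apply: valP z. Qed.
Fact fgmul1g : left_id fg1 fgmul.
Proof. by move=> x; apply: val_inj. Qed.
Fact fgmulg1 : right_id fg1 fgmul.
Proof. by move=> x; apply: val_inj; rewrite /= mulw0 //; apply: valP x. Qed.
Fact fgmulVg : left_inverse fg1 fginv fgmul.
Proof. by move=> x; apply: val_inj; rewrite /= mulVw. Qed.
Fact fgmulgV : right_inverse fg1 fginv fgmul.
Proof.
by move=> x; apply: val_inj => /=; rewrite -{1}[fgword x]invwK mulVw.
Qed.

HB.instance Definition _ := isGroup.Build freegroup
  fgmulA fgmul1g fgmulg1 fgmulVg fgmulgV.

Definition fggen (x : T) : freegroup := @FreeGroup [:: (x, true)] isT.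

End FreeGroup.

Section Lift.
Local Open Scope group_scope.
Variables (T : choiceType) (G : groupType) (f : T -> G).

Definition evall (l : T * bool) : G := if l.2 then f l.1 else (f l.1)^-1.

Definition fglift (x : freegroup T) : G := \prod_(l <- fgword x) evall l.

Lemma fglift_gen x : fglift (fggen x) = f x.
Proof. by rewrite /fglift big_seq1. Qed.

Lemma fgliftM x y : fglift (x * y) = fglift x * fglift y.
Proof.
have evalV l : evall (invl l) = (evall l)^-1.
  by case: l => a []; rewrite /evall /= ?invgK.
have redE l w : \prod_(k <- lcons_red l w) evall k =
    evall l * \prod_(k <- w) evall k.
  case: w => [|k w] /=; first by rewrite big_seq1 big_nil mulg1.
  case: eqP => [->|_]; last by rewrite big_cons.
  by rewrite big_cons evalV mulVKg.
rewrite /fglift /=; elim: (fgword x) => [|l w IH] /=.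
  by rewrite big_nil mul1g.
by rewrite redE IH big_cons mulgA.
Qed.

End Lift.

Section Subgroups.
Local Open Scope group_scope.
Variable G : groupType.
Implicit Types (X H : set G).

Definition is_subgroup H := group_closed (mem H).

Definition subgroup_gen X : set G := smallest is_subgroup X.

Definition finite_index H :=
  finite_set (range (fun g : G => [set h * g | h in H])).

(* X is a free basis of H: the morphism from the free group on X to G which
   extends the inclusion is injective, and X generates H. *)
Definition free_basis X H :=
  H = subgroup_gen X /\ injective (fglift (fun x : X => \val x)).

End Subgroups.

Section Words.
Variable A : choiceType.
Implicit Types (p q u v w : seq A) (X : set (seq A)).

Definition fg_of_word w : freegroup A := (\prod_(a <- w) fggen a)%g.

(* As usual for codes, the words of a code are nonempty: this only rules out
   the degenerate set consisting of the empty word. *)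
Definition bifix_code X :=
  [/\ ~ X [::],
      forall u v, X u -> X v -> prefix u v -> u = v
    & forall u v, X u -> X v -> suffix u v -> u = v].

Definition uniformly_recurrent X :=
  (forall u w, X w -> infix u w -> X u) /\
  (forall w, X w -> exists N : nat, 1 <= N /\
     forall w', X w' -> N <= size w' -> infix w w').

Definition prolongable X :=
  forall w, X w -> exists w', [/\ X w', prefix w w' & w <> w'].

End Words.

(* Connected and acyclic; an edge traversed back and forth is a ucycle of
   length 2, which is not a cycle of an undirected graph. *)
Definition graph_tree (V : finType) (P : pred V) (e : rel V) :=
  let e' := [rel x y | [&& P x, P y & e x y]] in
  [/\ exists x, P x,
      forall x y, P x -> P y -> connect e' x y
    & forall c : seq V, 2 < size c -> ~ ucycle e' c].

Section TreeSets.
Variable A : finType.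
Implicit Types (S : set (seq A)) (w : seq A).

Definition ext_vertex S w : pred (A + A) := fun v =>
  match v with
  | inl a => `[< S (a :: w) >]
  | inr b => `[< S (rcons w b) >]
  end.

Definition ext_edge S w : rel (A + A) := fun u v =>
  match u, v with
  | inl a, inr b | inr b, inl a => `[< S (a :: rcons w b) >]
  | _, _ => false
  end.

Definition tree_set S :=
  forall w, S w -> graph_tree (ext_vertex S w) (ext_edge S w).

End TreeSets.

Section Games.
Variable A : Type.
Implicit Types (T : set (seq A)) (W : set (nat -> A)) (p : seq A)
  (s : seq A -> A) (x : nat -> A).

Definition plays T : set (nat -> A) := [set x | forall n, T (mkseq x n)].

Definition plays_from T p : set (nat -> A) :=
  [set x | plays T x /\ mkseq x (size p) = p].

(* The values of s at positions of odd length, or outside T, are irrelevant. *)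
Definition strategy1 T s :=
  forall p, T p -> ~~ odd (size p) -> T (rcons p (s p)).

Definition consistent1 s x := forall n, ~~ odd n -> x n = s (mkseq x n).

Definition winning1 T W s :=
  forall x, plays T x -> consistent1 s x -> W x.

Definition player1_wins T W := exists s, strategy1 T s /\ winning1 T W s.

(* hat <a_1, ..., a_n> = <a_2, a_4, ...> *)
Fixpoint hat p : seq A := if p is _ :: c :: p' then c :: hat p' else [::].

End Games.

Section StrategyTree.
Variable A : eqType.
Implicit Types (S : set (seq A)) (s : seq A -> A).

(* Positions <a_1, c_1, ..., a_n, c_n> with <c_1, ..., c_n> in S and with a_(i+1),
   the entry of index 2i, played according to s. *)
Definition strategy_positions S s : set (seq A) :=
  [set p | [/\ ~~ odd (size p), S (hat p)
    & forall i, i.*2 < size p -> onth p i.*2 = Some (s (take i.*2 p))]].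

Definition strategy_tree S s : set (seq A) :=
  [set q | exists2 p, strategy_positions S s p & prefix q p].

End StrategyTree.

(* Main.v *)
From HB Require Import structures.
Require Import Defs.
From mathcomp Require Import all_boot all_fingroup.
From mathcomp Require Import boolp classical_sets functions cardinality.
From mathcomp Require Import zify.

Set Implicit Arguments.
Unset Strict Implicit.
Unset Printing Implicit Defensive.

(* The moves of Player 1 in T are forced, so Player 1 wins iff every infinite word
   with all its prefixes in S has a prefix in X, the set of the hat p for p in Z;
   write H for the subgroup generated by X.
   The acyclicity of the extension graphs transports edge labellings of a Rauzy
   graph with values in a group down to a labelling of the alphabet. Applied to
   the automaton that decodes X, whose letters act by partial injections because X
   is a suffix code, this gives a morphism from the free group to a wreath product
   that follows the decoding of X. Hence X is free, and a nonempty word of S in H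
   has a prefix in X.
   If X covers the infinite words, Koenig's lemma bounds the suffixes of u with no
   prefix in X; for long u the union Omega(u) of their cosets of H satisfies
   Omega(ua) = Omega(u)a and Omega(bu) = Omega(u). The connectedness of the
   extension graphs extends this to all u, so Omega(empty word) is stable under
   the generators: it is the whole group, and H has finite index. Conversely, if H
   has finite index, every infinite word has two recurring prefixes u and tu in the
   same coset of H, so that t is in H and has a prefix in X. *)

(** * Wreath products with a symmetric group *)

Section WreathProduct.
Local Open Scope group_scope.
Variables (Q : finType) (G : groupType).

(* The group of the permutations of Q * G that commute with the left
   multiplications of G; (g, s) maps (q, h) to (s q, h * g q). *)
Definition wreath : Type := ({ffun Q -> G} * {perm Q})%type.

HB.instance Definition _ := Choice.on wreath.

Implicit Types x y z : wreath.

Definition wr_mul x y : wreath := ([ffun q => x.1 q * y.1 (x.2 q)], x.2 * y.2).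
Definition wr_one : wreath := ([ffun=> 1], 1).
Definition wr_inv x : wreath := ([ffun q => (x.1 (x.2^-1 q))^-1], x.2^-1).

Fact wr_mulA : associative wr_mul.
Proof.
move=> [f s] [g t] [h u]; congr pair; rewrite /= ?mulgA //.
by apply/ffunP => q; rewrite !ffunE /= permM mulgA.
Qed.

Fact wr_mul1 : left_id wr_one wr_mul.
Proof.
move=> [f s]; congr pair; rewrite /= ?mul1g //.
by apply/ffunP => q; rewrite !ffunE /= perm1 mul1g.
Qed.

Fact wr_mulr1 : right_id wr_one wr_mul.
Proof.
move=> [f s]; congr pair; rewrite /= ?mulg1 //.
by apply/ffunP => q; rewrite !ffunE /= mulg1.
Qed.

Fact wr_mulV : left_inverse wr_one wr_inv wr_mul.
Proof.
move=> [f s]; congr pair; rewrite /= ?mulVg //.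
by apply/ffunP => q; rewrite !ffunE /= mulVg.
Qed.

Fact wr_mulrV : right_inverse wr_one wr_inv wr_mul.
Proof.
move=> [f s]; congr pair; rewrite /= ?mulgV //.
by apply/ffunP => q; rewrite !ffunE /= permK mulgV.
Qed.

HB.instance Definition _ :=
  isGroup.Build wreath wr_mulA wr_mul1 wr_mulr1 wr_mulV wr_mulrV.

Lemma wr_mulE x y : x * y = wr_mul x y.
Proof. by []. Qed.

Lemma wr_oneE : 1 = wr_one.
Proof. by []. Qed.

End WreathProduct.

(** * The decoding automaton of a suffix code and its partial injections *)

Lemma extend_perm (T : finType) (D : seq T) (f : T -> T) :
  {in D &, injective f} -> exists s : {perm T}, {in D, s =1 f}.
Proof.
elim: D => [|x D IH] injf; first by exists 1%g.
have [|s sf] := IH; first by move=> y z yD zD; apply: injf; rewrite inE ?yD ?zD orbT.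
have [xD|xD] := boolP (x \in D).
  by exists s => y; rewrite inE => /orP[/eqP->|]; apply: sf.
(* The transposition moves the value at [x] to [f x] and no value at a point of [D], by injectivity
   of [s] and of [f]. *)
exists (s * tperm (s x) (f x))%g => y; rewrite inE permM.
move=> /predU1P[->|yD]; first by rewrite tpermL.
have yx : y != x by apply: contraNneq xD => <-.
rewrite -(sf y yD) tpermD //; first by rewrite (inj_eq perm_inj) eq_sym.
by rewrite sf //; apply: contraNneq yx => /esym/injf-> //; rewrite inE ?eqxx ?yD ?orbT.
Qed.

Lemma suffix_le_size (T : eqType) (p q v : seq T) :
  suffix p v -> suffix q v -> size p <= size q -> suffix p q.
Proof.
move=> pv qv pq; have := size_suffix qv; move: pv qv.
rewrite !suffixE => /eqP pE /eqP qE qv.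
rewrite -{2}qE drop_drop -{2}pE; apply/eqP; congr drop; lia.
Qed.

Section Automaton.
Local Open Scope group_scope.
Variables (A : finType) (G : groupType) (X : set (seq A)) (c : seq A -> G).
Implicit Types (s : seq A * G) (q u v w : seq A).

(* The automaton that decodes X: it forgets the word read so far as soon as this
   word is in X, and multiplies the second component by the weight of the word. *)
Definition step s b :=
  let q := rcons s.1 b in if `[< X q >] then ([::], s.2 * c q) else (q, s.2).

Variable m : nat.

(* Words longer than m are fixed. *)
Definition wract s (x : wreath (m.-bseq A) G) : seq A * G :=
  if insub s.1 is Some q then (val (x.2 q), s.2 * x.1 q) else s.

Lemma wract1 s : wract s 1 = s.
Proof.
rewrite /wract wr_oneE; case: s => q h /=.
by case: insubP => //= q' _ qq'; rewrite perm1 ffunE mulg1 qq'.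
Qed.

Lemma wractM s x y : wract s (x * y) = wract (wract s x) y.
Proof.
rewrite /wract wr_mulE; case: s => q h /=; case: insubP => [q' _ qq' /=|qm /=].
  by rewrite valK permM ffunE mulgA.
by rewrite insubN.
Qed.

Definition proper_suffix q v := suffix q v && (size q < size v).

Hypothesis X_suf : forall u v, X u -> X v -> suffix u v -> u = v.

(** On the proper suffixes of a single word [v], reading [b] is injective: if [q b] and [r b] are in
    [X], both are suffixes of [v b], hence comparable, hence equal. Properness keeps the new state
    of length at most [m], so some permutation extends the step. *)
Lemma wract_extend v b : size v = m ->
  exists x, forall q h, proper_suffix q v -> wract (q, h) x = step (q, h) b.
Proof.
move=> vm.
pose D := [seq q : m.-bseq A <- enum {: m.-bseq A} | proper_suffix q v].
pose nx (q : seq A) := if `[< X (rcons q b) >] then [::] else rcons q b.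
have [s sD] : exists s : {perm m.-bseq A}, {in D, s =1 fun q : m.-bseq A => insubd q (nx q)}.
  apply: extend_perm => q r; rewrite !mem_filter /=.
  have nx_size (q' : m.-bseq A) : proper_suffix q' v -> size (nx q') <= m.
    by case/andP=> _; rewrite /nx; case: ifP => //; rewrite size_rcons vm.
  move=> /andP[qv _] /andP[rv _] /(congr1 val).
  rewrite !val_insubd !nx_size // /nx.
  case: asboolP => Xq; case: asboolP => Xr //.
  - move=> _; have ltq : suffix (rcons q b) (rcons r b) || suffix (rcons r b) (rcons q b).
      rewrite !suffix_rcons eqxx /=; case/andP: qv => qv _; case/andP: rv => rv _.
      have [sz|/ltnW sz] := leqP (size q) (size r); apply/orP; [left|right].
        exact: suffix_le_size qv rv sz.
      exact: suffix_le_size rv qv sz.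
    apply: val_inj; apply: (@rcons_injl _ b).
    by case/orP: ltq => [/(X_suf Xq Xr)|/(X_suf Xr Xq)].
  - by case: (val r).
  - by case: (val q).
  - by move=> E; apply: val_inj; apply: (@rcons_injl _ b).
exists ([ffun q : m.-bseq A =>
  if `[< X (rcons q b) >] then c (rcons q b) else 1], s) => q h qv.
have qm : size q <= m by case/andP: qv => _; rewrite vm => /ltnW.
rewrite /wract /= insubT /= ffunE sD /step /=; last first.
  by rewrite mem_filter qv mem_enum.
rewrite val_insubd /nx; case: asboolP => //= _; rewrite size_rcons mulg1.
by case/andP: qv => _; rewrite vm => ->.
Qed.

End Automaton.

(** * Group labellings of acyclic bipartite graphs *)

Section Potential.
Local Open Scope group_scope.
Variables (A : finType) (W : groupType) (K : set W).

Definition bipartite_rel (E : {set A * A}) : rel (A + A) := fun u v =>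
  match u, v with
  | inl a, inr b | inr b, inl a => (a, b) \in E
  | _, _ => false
  end.

Hypotheses (K1 : K 1) (KM : forall x y, K x -> K y -> K (x * y))
  (KV : forall x, K x -> K x^-1).

(* By induction on the edges: an edge that is put back joins two components, and
   the factorization of the others can be corrected along one of them. *)
Lemma forest_factorization (E : {set A * A}) (lab : A -> A -> W) :
  (forall c, 2 < size c -> ~ ucycle (bipartite_rel E) c) ->
  (forall a a' b, (a, b) \in E -> (a', b) \in E ->
     K (lab a b * (lab a' b)^-1)) ->
  exists f g, (forall a, K (f a)) /\
    forall a b, (a, b) \in E -> lab a b = f a * g b.
Proof.
elim/(ltn_ind) : {E}#|E| {-2}E (erefl #|E|) => n IH E En acE labK.
have [->|[[a0 b0] ab0]] := set_0Vmem E.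
  by exists (fun=> 1), (fun=> 1); split=> // a b; rewrite inE.
pose E' := E :\ (a0, b0).
have E'E u v : bipartite_rel E' u v -> bipartite_rel E u v.
  by case: u v => [a|b] [a'|b'] //=; rewrite !inE => /andP[].
have [|||f [g [fK fgE]]] := IH #|E'| _ E' erefl.
- by rewrite -En (cardsD1 (a0, b0) E) ab0.
- move=> c c2 /andP[cE uc]; apply: (acE c c2); rewrite /ucycle uc andbT.
  exact: sub_cycle cE.
- by move=> a a' b; rewrite !inE => /andP[_ abE] /andP[_ abE']; apply: labK.
(* If no other edge meets [b0], the value [g b0] is free and absorbs the label of the edge put
   back. *)
have [[a' ab']|nb0] := pselect (exists a', (a', b0) \in E'); last first.
  exists f, (fun b => if b == b0 then (f a0)^-1 * lab a0 b0 else g b).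
  split=> // a b abE; case: eqP => [bb0|nbb0].
    have [->|naa0] := eqVneq a a0; first by rewrite mulVKg bb0.
    by case: nb0; exists a; rewrite !inE -bb0 abE andbT xpair_eqE (negPf naa0).
  by apply: fgE; rewrite !inE abE andbT xpair_eqE (introF eqP nbb0) andbF.
have symE' : symmetric (bipartite_rel E') by move=> [a|b] [a1|b1].
pose C := connect (bipartite_rel E') (inl a0).
(* A path from [a0] to [b0] in [E'] would close with the removed edge into a cycle of [E], of length
   above 2 because that edge is not in [E']. *)
have nCb0 : ~~ C (inr b0).
  apply/negP => /connectP[p /shortenP[p' p'E up' _ lp']].
  apply: (acE (inl a0 :: p')).
    case: p' p'E {up'} lp' => [//|x [|y p']] //= /andP[x0 _] xb.
    by move: x0; rewrite -xb /= !inE eqxx.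
  rewrite /ucycle up' andbT /= rcons_path (sub_path E'E p'E) /= -lp' /=.
  by [].
(* The correction needed at [(a0, b0)]. Applied on all of [C], with its inverse on the other side,
   it changes no product along an edge of [E']; the edge [(a', b0)] shows that it lies in [K]. *)
pose k := (f a0)^-1 * lab a0 b0 * (g b0)^-1.
have Kk : K k.
  have <- : (f a0)^-1 * (lab a0 b0 * (lab a' b0)^-1) * f a' = k.
    rewrite (fgE _ _ ab') invgM /k -!mulgA; do 2 congr (_ * _).
    by rewrite mulVg mulg1.
  apply/KM/fK/KM/labK => //; first exact/KV/fK.
  by move: ab'; rewrite !inE => /andP[].
exists (fun a => if C (inl a) then f a * k else f a).
exists (fun b => if C (inr b) then k^-1 * g b else g b); split.
  by move=> a; case: ifP => _ //; apply: KM.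
move=> a b abE; have [[-> ->]|nab] := eqVneq (a, b) (a0, b0).
  by rewrite (negPf nCb0) /C connect0 /k !mulgA mulgV mul1g mulgVK.
have abE' : (a, b) \in E' by rewrite !inE nab.
have -> : C (inl a) = C (inr b).
  have csym : connect_sym (bipartite_rel E') by apply: sym_connect_sym.
  by apply: (same_connect_r csym); apply: connect1.
by rewrite (fgE _ _ abE'); case: ifP => // _; rewrite -mulgA mulVKg.
Qed.

End Potential.

(** * Descent along Rauzy graphs *)

Section Descent.
Local Open Scope group_scope.
Variables (A : finType) (G : groupType) (X : set (seq A)) (c : seq A -> G).
Variables (S : set (seq A)) (m : nat).
Local Notation W := (wreath (m.-bseq A) G).
Local Notation act := (@wract A G m).
Local Notation stepX := (step X c).
Implicit Types (x y : W) (q u v w : seq A).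

Hypothesis S_infix : forall u w, S w -> infix u w -> S u.
Hypothesis S_left : forall w, S w -> exists a, S (a :: w).
Hypothesis S_acyclic : forall w, S w -> forall s : seq (A + A), 2 < size s ->
  ~ ucycle [rel x y | [&& ext_vertex S w x, ext_vertex S w y & ext_edge S w x y]] s.

Definition fixes x q := forall h, act (q, h) x = (q, h).
Definition reads x q b := forall h, act (q, h) x = stepX (q, h) b.

Lemma fixesM x y q : fixes x q -> fixes y q -> fixes (x * y) q.
Proof. by move=> fx fy h; rewrite wractM fx fy. Qed.

Lemma fixesV x q : fixes x q -> fixes x^-1 q.
Proof. by move=> fx h; rewrite -{1}(fx h) -wractM mulgV wract1. Qed.

(* Labels on the edges of the Rauzy graph of order k, that is on the words of S
   of length k.+1, are transported to the order k.-1 along the extension graphs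
   until only one vertex is left. *)
Lemma descent k (lab : seq A -> A -> W) :
  (forall v b q, S (rcons v b) -> size v = k -> proper_suffix q v ->
     reads (lab v b) q b) ->
  exists (Pi : A -> W) (psi : seq A -> W),
    (forall v, S v -> size v = k -> fixes (psi v) [::]) /\
    (forall v b, S (rcons v b) -> size v = k ->
       lab v b = psi v * Pi b * (psi (behead (rcons v b)))^-1).
Proof.
elim: k lab => [|k IH] lab labP.
  exists (lab [::]), (fun=> 1); split; first by move=> v _ _ h; rewrite wract1.
  by move=> v b _ /size0nil->; rewrite mul1g invg1 mulg1.
(* The left factors are taken among the elements fixing every suffix of [w]: on such a suffix
   [lab (a :: w) b] and [lab (a' :: w) b] both read [b], so their quotient fixes it. *)
have /choice[fg fgP] : forall w, exists fg : (A -> W) * (A -> W),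
    S w -> size w = k ->
    (forall a q, suffix q w -> fixes (fg.1 a) q) /\
    (forall a b, S (a :: rcons w b) -> lab (a :: w) b = fg.1 a * fg.2 b).
  move=> w; have [[Sw wk]|n] := pselect (S w /\ size w = k); last first.
    by exists (fun=> 1, fun=> 1) => Sw wk; case: n.
  pose E : {set A * A} := [set ab | `[< S (ab.1 :: rcons w ab.2) >]]%SET.
  have [|||||f [g [fK fg]]] := @forest_factorization A W
    [set x | forall q, suffix q w -> fixes x q] _ _ _ E (fun a => lab (a :: w)).
  - by move=> q _ h; rewrite wract1.
  - by move=> x y fx fy q qw; apply: fixesM; [apply: fx|apply: fy].
  - by move=> x fx q qw; apply/fixesV/fx.
  - move=> s s2 /andP[cs us]; apply: (S_acyclic Sw s2).
    rewrite /ucycle us andbT; apply: sub_cycle cs => u v.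
    have vE a b : (a, b) \in E -> [&& `[< S (a :: w) >], `[< S (rcons w b) >] &
        `[< S (a :: rcons w b) >] ].
      rewrite !inE /= => Sab; apply/and3P; split; apply/asboolP => //.
      + by apply: (S_infix Sab); rewrite -rcons_cons; apply/prefixW/prefix_rcons.
      + by apply: (S_infix Sab); apply/suffixW/suffix_cons.
    case: u v => [a|b] [a'|b'] //= /vE /and3P[-> -> ->]; by [].
  - move=> a a' b; rewrite !inE /= => Sa Sa' q qw h.
    have rd a1 : S (a1 :: rcons w b) -> reads (lab (a1 :: w) b) q b.
      move=> Sa1; apply: labP; rewrite ?rcons_cons //= ?wk //.
      rewrite /proper_suffix /= (suffix_trans qw (suffix_cons _ _)) ltnS.
      exact: size_suffix.
    by rewrite wractM (rd a Sa) -(rd a' Sa') -wractM mulgV wract1.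
  exists (f, g) => _ _; split=> [a q|a b Sab]; first exact: fK.
  by apply: fg; rewrite !inE.
pose F v := if v is a :: w then (fg w).1 a else 1.
have F_fixes v q : S v -> size v = k.+1 -> proper_suffix q v -> fixes (F v) q.
  case: v => [//|a w] Sw [wk] /andP[qw qk]; have Sw' : S w.
    by apply: (S_infix Sw); apply/suffixW/suffix_cons.
  have [fw _] := fgP w Sw' wk; apply: fw.
  exact: suffix_le_size qw (suffix_cons _ _) qk.
(* The right factor at [w] is merged with the left factor at the next vertex, so that
   [lab (a :: w) b] is [F (a :: w)] times the new label times the inverse of [F (rcons w b)]. The
   new label still reads [b], as [F] fixes the state reached. *)
have [|Pi [psi [psi1 labE]]] := IH (fun w b => (fg w).2 b * F (rcons w b)).
  move=> w b q Swb wk qw h; have [a Sawb] := S_left Swb.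
  have Sw : S w by apply: (S_infix Swb); apply/prefixW/prefix_rcons.
  have [fw labE] := fgP w Sw wk.
  have -> : (fg w).2 b = ((fg w).1 a)^-1 * lab (a :: w) b.
    by rewrite (labE _ _ Sawb) mulKg.
  have /andP[qw' qwk] := qw.
  rewrite !wractM (fixesV (fw a q qw')) (labP (a :: w)) ?rcons_cons //=; first last.
  - by rewrite /proper_suffix (suffix_trans qw' (suffix_cons _ _)) /= ltnW.
  - by rewrite wk.
  rewrite /step /=; case: asboolP => _; apply: F_fixes => //;
    by rewrite ?size_rcons ?wk // /proper_suffix ?suffix0s ?suffix_rcons ?eqxx ?qw' !size_rcons.
exists Pi, (fun v => F v * psi (behead v)); split.
  move=> [//|a w] Sw [wk]; apply: fixesM.
    by apply: F_fixes; rewrite ?/proper_suffix ?suffix0s /= ?wk.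
  by apply: psi1 => //; apply: (S_infix Sw); apply/suffixW/suffix_cons.
move=> [//|a w] b Sawb [wk].
have Swb : S (rcons w b) by apply: (S_infix Sawb); apply/suffixW/suffix_cons.
have Sw : S w by apply: (S_infix Swb); apply/prefixW/prefix_rcons.
have [_ labf] := fgP w Sw wk.
rewrite labf // invgM -/(F (a :: w)) /= -!mulgA; congr (_ * _).
by rewrite !mulgA -labE // mulgK.
Qed.

Hypothesis X_suf : forall u v, X u -> X v -> suffix u v -> u = v.

Lemma left_context n u : S u -> exists2 v, size v = n & S (v ++ u).
Proof.
move=> Su; elim: n => [|n [v vn Svu]]; first by exists [::].
by have [a Sa] := S_left Svu; exists (a :: v); rewrite /= ?vn.
Qed.

Definition X_free u := forall p, prefix p u -> ~ X p.

Lemma X_free_step u b h : X_free (rcons u b) ->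
  stepX (u, h) b = (rcons u b, h).
Proof.
by move=> Xu; rewrite /step /=; case: asboolP => // /(Xu _ (prefix_refl _)).
Qed.

Lemma X_free_rcons u b : X_free (rcons u b) -> X_free u.
Proof. by move=> Xu p /prefix_trans pu; apply/Xu/pu/prefix_rcons. Qed.

(** The word is read after a left context [v] of length [m]. Along the resulting path in the Rauzy
    graph of order [m] the factors [psi] telescope: the initial one fixes the empty state and
    disappears, the final one is [y]. *)
Lemma automaton_representation : exists Pi : A -> W,
  (forall u b, S (rcons u b) -> size u < m -> X_free u -> forall h,
     exists y, fixes y [::] /\
     act ([::], h) (\prod_(a <- rcons u b) Pi a) = act (stepX (u, h) b) y).
Proof.
have /choice[lab labP] : forall v, exists lab : A -> W, forall b q,
    size v = m -> proper_suffix q v -> reads (lab b) q b.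
  move=> v; have [vm|nvm] := eqVneq (size v) m; last first.
    by exists (fun=> 1) => b q vm; rewrite vm eqxx in nvm.
  have /choice[lab labP] := fun b => wract_extend c X_suf b vm.
  by exists lab => b q _ qv h; apply: labP.
have [|Pi [psi [psi1 labE]]] := @descent m lab.
  by move=> v b q _ vm qv; apply: labP.
(* As [size v = m], [ctx u v] consists of the last [m] letters of [v ++ u]: the vertex reached from
   [v] by reading [u]. *)
pose Phi u := \prod_(a <- u) Pi a; pose ctx u v := drop (size u) (v ++ u).
have stepE u b v h : S (v ++ rcons u b) -> size v = m -> size u < m ->
    act ([::], h) (psi v * Phi u) = act (u, h) (psi (ctx u v)) ->
    act ([::], h) (psi v * Phi (rcons u b)) =
    act (stepX (u, h) b) (psi (ctx (rcons u b) v)).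
  move=> Svub vm um IH; have le_u : size u <= size (v ++ u).
    by rewrite size_cat leq_addl.
  have ctxE : ctx (rcons u b) v = behead (rcons (ctx u v) b).
    by rewrite /ctx size_rcons -rcons_cat -drop_rcons // -drop1 drop_drop.
  rewrite /Phi -cats1 big_cat big_seq1 /= mulgA wractM IH -wractM cats1.
  have -> : psi (ctx u v) * Pi b = lab (ctx u v) b * psi (ctx (rcons u b) v).
    rewrite labE ?ctxE ?mulgVK //; last by rewrite size_drop size_cat vm addnK.
    apply: (S_infix Svub); apply: suffixW; rewrite -rcons_cat suffix_rcons eqxx.
    exact: suffix_drop.
  rewrite wractM labP //; first by rewrite size_drop size_cat vm addnK.
  rewrite /proper_suffix size_drop size_cat addnK vm um andbT.
  by rewrite suffixE size_drop size_cat addnK drop_drop vm (subnK (ltnW um)) -vm drop_size_cat.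
have pathE u v h : S (v ++ u) -> size v = m -> size u <= m -> X_free u ->
    act ([::], h) (psi v * Phi u) = act (u, h) (psi (ctx u v)).
  elim/last_ind: u => [|u b IH] Svu vm um Xu.
    by rewrite /ctx /Phi big_nil mulg1 drop0 cats0.
  rewrite size_rcons in um.
  rewrite stepE // ?X_free_step // IH ?(ltnW um) //; last exact: X_free_rcons Xu.
  by apply: (S_infix Svu); rewrite -rcons_cat; apply/prefixW/prefix_rcons.
exists Pi => u b Sub um Xu h; have [v vm Svub] := left_context m Sub.
have Sv : S v by apply: (S_infix Svub); apply/prefixW/prefix_prefix.
exists (psi (ctx (rcons u b) v)); split.
  apply: psi1; last by rewrite size_drop size_cat vm addnK.
  by apply: (S_infix Svub); apply/suffixW/suffix_drop.
rewrite -[in LHS](psi1 v Sv vm h) -wractM; apply: stepE => //.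
apply: pathE => //; last exact: ltnW.
by apply: (S_infix Svub); rewrite -rcons_cat; apply/prefixW/prefix_rcons.
Qed.

End Descent.

(** * Morphisms from free groups and generated subgroups *)

Section FreeGroupMorphisms.
Local Open Scope group_scope.

Lemma fglift1 (T : choiceType) (G : groupType) (f : T -> G) : fglift f 1 = 1.
Proof. by rewrite /fglift big_nil. Qed.

Lemma fgliftV (T : choiceType) (G : groupType) (f : T -> G) x :
  fglift f x^-1 = (fglift f x)^-1.
Proof. by apply: (mulIg (fglift f x)); rewrite -fgliftM !mulVg fglift1. Qed.

Lemma fglift_word (A : choiceType) (G : groupType) (f : A -> G) (u : seq A) :
  fglift f (fg_of_word u) = \prod_(a <- u) f a.
Proof.
elim: u => [|a u IH]; first by rewrite /fg_of_word !big_nil fglift1.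
by rewrite /fg_of_word !big_cons fgliftM fglift_gen -IH.
Qed.

Lemma fglift_fggen (T : choiceType) (x : freegroup T) : fglift (@fggen T) x = x.
Proof.
apply: val_inj; case: x => w rw; rewrite /fglift /=.
elim: w rw => [|l w IH] rlw; first by rewrite big_nil.
move: (rlw); rewrite reduced_cons => /andP[wl rw].
rewrite big_cons; have -> : evall (@fggen T) l = FreeGroup (isT : reduced [:: l]).
  by apply: val_inj; case: l {rlw wl} => a [].
rewrite /= IH // /lcons_red; case: w wl {IH rw rlw} => [//|k w].
by move/negbTE->.
Qed.

Lemma fg_of_word_cat (A : choiceType) (u v : seq A) :
  fg_of_word (u ++ v) = fg_of_word u * fg_of_word v.
Proof. exact: big_cat. Qed.

End FreeGroupMorphisms.

Section GeneratedSubgroup.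
Local Open Scope group_scope.
Variables (G : groupType).
Implicit Types (X H : set G).

Lemma is_subgroupP H : is_subgroup H <->
  [/\ H 1, forall x y, H x -> H y -> H (x * y) & forall x, H x -> H x^-1].
Proof.
split=> [HH|[H1 HM HV]].
  split; first by case: HH => /set_mem.
    by move=> x y Hx Hy; apply/set_mem/(group_closedM HH); apply/mem_set.
  by move=> x Hx; apply/set_mem/(group_closedV HH)/mem_set.
split; first exact/mem_set.
by move=> x y /set_mem Hx /set_mem Hy; apply/mem_set/HM/HV.
Qed.

Lemma subgroup_gen_is_subgroup X : is_subgroup (subgroup_gen X).
Proof.
apply/is_subgroupP; split.
- by move=> H [HH _]; case: (is_subgroupP H).1.
- move=> x y Xx Xy H HX; case: (HX) => /is_subgroupP[_ HM _] _.
  by apply: HM; [apply: Xx|apply: Xy].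
- move=> x Xx H HX; case: (HX) => /is_subgroupP[_ _ HV] _.
  by apply: HV; apply: Xx.
Qed.

Lemma subgroup_gen_ind X (P : G -> Prop) :
  P 1 -> (forall x, X x -> P x) ->
  (forall x y, P x -> P y -> P (x * y)) -> (forall x, P x -> P x^-1) ->
  forall x, subgroup_gen X x -> P x.
Proof.
by move=> P1 PX PM PV x Xx; apply: (Xx P); split=> //; apply/is_subgroupP.
Qed.

End GeneratedSubgroup.

(** * Freeness of the code, and the words of [S] in the subgroup it generates *)

Section BifixCodes.
Local Open Scope group_scope.
Local Open Scope classical_set_scope.
Variables (A : finType) (S X : set (seq A)).
Implicit Types u v w : seq A.

Hypothesis S_infix : forall u w, S w -> infix u w -> S u.
Hypothesis S_left : forall w, S w -> exists a, S (a :: w).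
Hypothesis S_acyclic : forall w, S w -> forall s : seq (A + A), 2 < size s ->
  ~ ucycle [rel x y | [&& ext_vertex S w x, ext_vertex S w y & ext_edge S w x y]] s.
Hypothesis X_bifix : bifix_code X.
Hypothesis X_sub : X `<=` S.

Local Notation fgX := [set fg_of_word u | u in X].

(** As [X] is a prefix code, the automaton reads a word of [X] without returning to the empty state
    before its end. An [X]-free word ends in a nonempty state, which the invertible [y] cannot send
    to the empty state that it fixes. *)
Lemma morphism_representation (G : groupType) (c : seq A -> G) m :
  exists f : A -> wreath (m.-bseq A) G,
  (forall u, X u -> size u <= m -> forall h,
     wract ([::], h) (fglift f (fg_of_word u)) = ([::], h * c u)) /\
  (forall u, S u -> u != [::] -> size u <= m -> X_free X u -> forall h,
     (wract ([::], h) (fglift f (fg_of_word u))).1 != [::]).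
Proof.
have [X0 X_pre X_suf] := X_bifix.
have [f fP] := automaton_representation c m S_infix S_left S_acyclic X_suf.
exists f; split=> u; case/lastP: u => [//|u b].
  move=> Xub; rewrite size_rcons => um h; rewrite fglift_word.
  have [|y [y1 ->]] := fP u b (X_sub Xub) um _ h.
    move=> p pu Xp; have pub := prefix_trans pu (prefix_rcons u b).
    have pE := X_pre _ _ Xp Xub pub.
    by have := size_prefix pu; rewrite pE size_rcons ltnn.
  by rewrite /step /= (asboolT Xub) y1.
move=> Sub _; rewrite size_rcons => um Xub h; rewrite fglift_word.
have [y [y1 ->]] := fP u b Sub um (X_free_rcons Xub) h.
rewrite X_free_step //; case E: (wract _ _) => [q k]; apply/eqP => /= q0.
have : wract ([::], k) y^-1 = (rcons u b, h).
  by rewrite -q0 -E -wractM mulgV wract1.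
by rewrite (fixesV y1) => -[]; case: (u).
Qed.

(** The words of [X], hence all elements of the subgroup, fix the empty state, whereas a nonempty
    [X]-free word of [S] moves it. *)
Lemma subgroup_gen_prefix u : S u -> u != [::] ->
  subgroup_gen fgX (fg_of_word u) -> exists2 p, X p & prefix p u.
Proof.
move=> Su u0 Hu; apply: contrapT => nX.
have Xu : X_free X u by move=> p pu Xp; apply: nX; exists p.
pose G := freegroup A.
(* The code may be infinite, but an element of the subgroup involves finitely many of its words,
   which fit in every large enough [m]. *)
pose P g := exists N, forall m (f : A -> wreath (m.-bseq A) G), N <= m ->
  (forall v, X v -> size v <= m -> fixes (fglift f (fg_of_word v)) [::]) ->
  fixes (fglift f g) [::].
have [N NP] : P (fg_of_word u).
  elim/subgroup_gen_ind : Hu => [|_ [v Xv <-]|x y [N NP] [N' NP']|x [N NP]].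
  - by exists 0 => m f _ _ h; rewrite fglift1 wract1.
  - by exists (size v) => m f vm fX; apply: fX.
  - exists (maxn N N') => m f; rewrite geq_max => /andP[Nm N'm] fX.
    by rewrite fgliftM; apply: fixesM; [apply: NP|apply: NP'].
  - exists N => m f Nm fX; rewrite fgliftV.
    by apply/fixesV/NP.
have [f [fX fS]] := morphism_representation (fun=> 1 : G) (maxn N (size u)).
have /eqP := fS u Su u0 (leq_maxr _ _) Xu 1; apply; rewrite (NP _ f) //.
  exact: leq_maxl.
by move=> v Xv vm h; rewrite fX ?mulg1.
Qed.

(** With weights in the free group on the code, the image of [w] sends [([::], 1)] to [([::], w)],
    so [w] can be recovered from its image. *)
Lemma bifix_code_free : injective (fglift (fun x : fgX => \val x)).
Proof.
have /choice[word wordP] : forall x : fgX, exists u, X u /\ fg_of_word u = \val x.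
  by move=> x; have /set_mem[u Xu ux] := valP x; exists u.
(* The weight of [u] depends only on its image in the free group, so the choice of [word x] does not
   matter; 1 is a default value outside the code. *)
pose c u : freegroup fgX := if insub (fg_of_word u) is Some x then fggen x else 1.
move=> w1 w2 w12.
pose letters := fgword w1 ++ fgword w2.
pose m := \max_(l <- letters) size (word l.1).
have [f [fX _]] := morphism_representation c m.
have act_gen x h : size (word x) <= m ->
    wract ([::], h) (fglift f (\val x)) = ([::], h * fggen x).
  move=> xm; have [Xx xE] := wordP x.
  by rewrite -{1}xE fX // /c xE valK.
have act_letters s h : {subset s <= letters} ->
    wract ([::], h) (fglift f (\prod_(l <- s) evall (fun x : fgX => \val x) l)) =
    ([::], h * \prod_(l <- s) evall (@fggen _) l).
  elim: s h => [|[x e] s IH] h sub_s.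
    by rewrite !big_nil fglift1 wract1 mulg1.
  have xm : size (word x) <= m.
    apply: (@leq_bigmax_seq _ letters xpredT (fun l => size (word l.1)) (x, e)) => //.
    by apply: sub_s; rewrite inE eqxx.
  have {}IH k := IH k (fun l ls => sub_s l (mem_behead (ls : l \in behead (_ :: s)))).
  rewrite !big_cons fgliftM wractM mulgA -IH; congr wract.
  case: e {sub_s} => /=; first exact: act_gen.
  by rewrite /evall /= fgliftV -{1}[h](mulgVK (fggen x)) -act_gen // -wractM mulgV wract1.
have act_w (w : freegroup fgX) : {subset fgword w <= letters} ->
    wract ([::], 1) (fglift f (fglift (fun x : fgX => \val x) w)) = ([::], w).
  move=> sw; have := act_letters (fgword w) 1 sw; rewrite mul1g.
  by rewrite [X in _ = (_, X)](fglift_fggen w).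
have s1 : {subset fgword w1 <= letters} by move=> l lw; rewrite mem_cat lw.
have s2 : {subset fgword w2 <= letters} by move=> l lw; rewrite mem_cat lw orbT.
have E := congr1 (fun g => wract ([::], 1) (fglift f g)) w12.
by case: (etrans (esym (act_w w1 s1)) (etrans E (act_w w2 s2))).
Qed.

End BifixCodes.

(** * Finite index from bounded parses *)

Lemma count_le1 (T : eqType) (p : pred T) (s : seq T) : uniq s ->
  (forall x y, x \in s -> y \in s -> p x -> p y -> x = y) -> count p s <= 1.
Proof.
move=> us ps; rewrite -size_filter.
have := filter_uniq p us; have : {subset filter p s <= [pred x | (x \in s) && p x]}.
  by move=> x; rewrite mem_filter inE andbC.
case: (filter p s) => [|x [|y r]] //= sub.
have /andP[xs px] := sub x (mem_head _ _).
have /andP[ys py] : (y \in s) && p y by apply: sub; rewrite !inE eqxx orbT.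
by rewrite inE (ps x y) ?eqxx.
Qed.

Lemma connect_invariant (V : finType) (T : Type) (e : rel V) (f : V -> T) x y :
  (forall x y, e x y -> f x = f y) -> connect e x y -> f x = f y.
Proof.
move=> ef /connectP[p]; elim: p x => [|z p IH] x /=; first by move=> _ ->.
by move=> /andP[/ef-> ?]; apply: IH.
Qed.

Section FiniteIndex.
Local Open Scope group_scope.
Local Open Scope classical_set_scope.
Variables (A : finType) (S X : set (seq A)).
Implicit Types (u v w q : seq A).

Hypothesis S_infix : forall u w, S w -> infix u w -> S u.
Hypothesis S_left : forall w, S w -> exists a, S (a :: w).
Hypothesis S_connected : forall w, S w -> forall x y,
  ext_vertex S w x -> ext_vertex S w y ->
  connect [rel x y | [&& ext_vertex S w x, ext_vertex S w y & ext_edge S w x y]] x y.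
Hypothesis S_alph : forall a, S [:: a].
Hypothesis S_nil : S [::].
Hypothesis S_rec : forall w, S w ->
  exists N, forall w', S w' -> N <= size w' -> infix w w'.
Hypothesis X_bifix : bifix_code X.

Variable M : nat.
Hypothesis X_prefix : forall u, S u -> M <= size u -> exists2 p, X p & prefix p u.

Local Notation H := (subgroup_gen [set fg_of_word u | u in X]).

(* The suffixes of u with no prefix in X are the starting points of the possible
   parses of u by X. *)
Fixpoint free_suffixes u : seq (seq A) :=
  if u is b :: u' then
    if `[< X_free X u >] then u :: free_suffixes u' else free_suffixes u'
  else [:: [::]].

Lemma free_suffixesP u q : q \in free_suffixes u -> suffix q u /\ X_free X q.
Proof.
have [X0 _ _] := X_bifix.
elim: u => [|b u IH] /=.
  rewrite inE => /eqP->; split=> // p; rewrite prefixs0 => /eqP->; exact: X0.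
have IH' : q \in free_suffixes u -> suffix q (b :: u) /\ X_free X q.
  by move=> /IH[qu Xq]; split=> //; apply: suffix_trans qu (suffix_cons _ _).
by case: asboolP => // Xbu; rewrite inE => /predU1P[->|//]; rewrite suffix_refl.
Qed.

Lemma free_suffixes_uniq u : uniq (map size (free_suffixes u)).
Proof.
elim: u => //= b u IH; case: ifP => //= _; rewrite IH andbT.
apply/mapP => -[q /free_suffixesP[/size_suffix qu _] qE].
by rewrite -qE ltnn in qu.
Qed.

Lemma X_free_rconsP u a : X_free X (rcons u a) <-> X_free X u /\ ~ X (rcons u a).
Proof.
split=> [Xua|[Xu Xua] p]; first by split; [apply: X_free_rcons Xua|exact/Xua/prefix_refl].
move=> /prefixP[s]; case/lastP: s => [|s b]; first by rewrite cats0 => <-.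
rewrite -rcons_cat => /rcons_inj[uE _]; apply: Xu; rewrite uE.
exact: prefix_prefix.
Qed.

(** A free suffix is lost only when the new letter turns it into a word of [X]; the empty suffix is
    added. *)
Lemma free_suffixes_rcons u a : free_suffixes (rcons u a) =
  rcons [seq q <- map (rcons^~ a) (free_suffixes u) | ~~ `[< X q >]] [::].
Proof.
have [X0 _ _] := X_bifix.
elim: u => [|b u IH] /=.
  have -> : `[< X_free X [:: a] >] = ~~ `[< X [:: a] >].
    rewrite -asbool_neg; apply: asbool_equiv_eq.
    rewrite -[[:: a]]/(rcons [::] a) X_free_rconsP; split=> [[]//|Xa]; split=> // p.
    by rewrite prefixs0 => /eqP->.
  by case: ifP.
have -> : `[< X_free X (b :: rcons u a) >] =
    `[< X_free X (b :: u) >] && ~~ `[< X (b :: rcons u a) >].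
  rewrite -asbool_neg -asbool_and; apply: asbool_equiv_eq.
  exact: (X_free_rconsP (b :: u)).
by rewrite IH; do 2 case: asboolP => //= ?.
Qed.

Lemma size_free_suffixes_rcons u a :
  size (free_suffixes (rcons u a)) + count (fun q => `[< X (rcons q a) >]) (free_suffixes u)
  = (size (free_suffixes u)).+1 /\
  count (fun q => `[< X (rcons q a) >]) (free_suffixes u) <= 1.
Proof.
have [_ _ X_suf] := X_bifix; split.
  rewrite free_suffixes_rcons size_rcons size_filter addSn; congr _.+1.
  rewrite count_map -(count_predC (fun q => `[< X (rcons q a) >])) addnC.
  by congr addn; apply: eq_count.
apply: count_le1; first exact: map_uniq (free_suffixes_uniq u).
move=> q r /free_suffixesP[qu _] /free_suffixesP[ru _] /asboolP Xq /asboolP Xr.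
apply: (@rcons_injl _ a); have [qr|/ltnW rq] := leqP (size q) (size r).
  by apply: X_suf; rewrite // suffix_rcons eqxx (suffix_le_size qu ru).
by symmetry; apply: X_suf; rewrite // suffix_rcons eqxx (suffix_le_size ru qu).
Qed.

(** A letter on the left removes no free suffix; a letter on the right adds one and, [X] being a
    suffix code, removes at most one. *)
Lemma size_free_suffixes_infix u v : infix u v ->
  size (free_suffixes u) <= size (free_suffixes v).
Proof.
move=> /infixP[p [s ->]]; elim: p => [|b p IH] /=; last first.
  by case: ifP => _ //; apply: leq_trans IH _ => /=.
elim/last_ind: s => [|s a IH]; first by rewrite cats0.
apply: leq_trans IH _; rewrite -rcons_cat.
have [] := size_free_suffixes_rcons (u ++ s) a; lia.
Qed.

Lemma size_free_suffixes_bound u : S u -> size (free_suffixes u) <= M.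
Proof.
move=> Su; rewrite -(size_map size) -(size_iota 0 M).
apply: uniq_leq_size; first exact: free_suffixes_uniq.
move=> _ /mapP[q /free_suffixesP[qu Xq] ->]; rewrite mem_iota /= ltnNge.
apply/negP => /(X_prefix (S_infix Su (suffixW qu)))[p Xp pq]; exact: Xq pq Xp.
Qed.

(** The number of free suffixes is bounded, and monotone for factors. A word of [S] where it is
    maximal occurs in every long word, where it is then maximal too: a letter on the left adds
    nothing, and one on the right must remove a suffix. *)
Lemma free_suffixes_stable : exists N, forall u, S u -> N <= size u ->
  (forall b, S (b :: u) -> free_suffixes (b :: u) = free_suffixes u) /\
  (forall a, S (rcons u a) -> exists2 q, q \in free_suffixes u & X (rcons q a)).
Proof.
have [d [u0 Su0 u0d] maxd] : exists2 d, exists2 u0, S u0 & size (free_suffixes u0) = d &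
    forall u, S u -> size (free_suffixes u) <= d.
  pose P d := `[< exists2 u, S u & size (free_suffixes u) = d >].
  have exP : exists d, P d by exists (size (free_suffixes [::])); apply/asboolP; exists [::].
  have bP d : P d -> d <= M by move=> /asboolP[u Su <-]; apply: size_free_suffixes_bound.
  case: (ex_maxnP exP bP) => d /asboolP dP dmax; exists d => // u Su.
  by apply: dmax; apply/asboolP; exists u.
have [N NP] := S_rec Su0; exists N => u Su Nu.
have ud v : S v -> N <= size v -> size (free_suffixes v) = d.
  move=> Sv Nv; apply/eqP; rewrite eqn_leq maxd //= -u0d.
  exact/size_free_suffixes_infix/NP.
split=> [b Sbu|a Sua].
  have := ud (b :: u) Sbu (leqW Nu) => /=; case: ifP => //= _.
  by rewrite (ud u Su Nu) => /esym /n_Sn.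
have [] := size_free_suffixes_rcons u a.
rewrite (ud u Su Nu) ud ?size_rcons ?(leqW Nu) // => cE _.
have : has (fun q => `[< X (rcons q a) >]) (free_suffixes u).
  by rewrite has_count -(ltn_add2l d) addn0 cE.
by move=> /hasP[q qu /asboolP Xq]; exists q.
Qed.

(** Inclusion in finitely many cosets suffices, since the set at the empty word turns out to be the
    whole group. *)
Definition coset_cover (O : set (freegroup A)) := O 1 /\
  exists s : seq (seq A), forall g, O g -> exists2 q, q \in s & H (g * (fg_of_word q)^-1).

(** The properties of the union of the cosets of the free suffixes of a long word, isolated so that
    they can be carried down to short words. *)
Definition coset_system k (Om : seq A -> set (freegroup A)) :=
  [/\ forall u a, S (rcons u a) -> k <= size u ->
        forall g, Om (rcons u a) g <-> Om u (g * (fggen a)^-1),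
      forall b u, S (b :: u) -> k <= size u -> Om (b :: u) = Om u
    & forall u, S u -> k <= size u -> coset_cover (Om u)].

Lemma fg_of_word_rcons u a : fg_of_word (rcons u a) = fg_of_word u * fggen a.
Proof. by rewrite -cats1 fg_of_word_cat /fg_of_word big_seq1. Qed.

Lemma coset_system_large : exists k Om, coset_system k Om.
Proof.
have [N NP] := free_suffixes_stable.
have HP := is_subgroupP H; have [/(_ (subgroup_gen_is_subgroup _))[H1 HM HV] _] := HP.
exists N, (fun u => [set g | exists2 q, q \in free_suffixes u & H (g * (fg_of_word q)^-1)]).
split=> [u a Sua uN g|b u Sbu uN|u Su uN].
- have Su : S u by apply: (S_infix Sua); apply/prefixW/prefix_rcons.
  (* The letter [a] carries the coset of [q0] to [H] itself, which is the coset of the new empty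
     suffix. *)
  have [_ /(_ a Sua)[q0 q0u Xq0]] := NP u Su uN.
  have HX q : X q -> H (fg_of_word q) by move=> Xq K [_ KX]; apply: KX; exists q.
  have shift q : g * (fggen a)^-1 * (fg_of_word q)^-1 = g * (fg_of_word (rcons q a))^-1.
    by rewrite fg_of_word_rcons invgM mulgA.
  split=> -[q] /=.
    rewrite free_suffixes_rcons mem_rcons inE => /predU1P[-> Hg|].
      exists q0 => //=; rewrite shift; apply: HM; last by apply: HV; apply: HX.
      by move: Hg; rewrite /fg_of_word big_nil invg1 mulg1.
    by rewrite mem_filter => /andP[_ /mapP[r ru ->]]; exists r => //=; rewrite shift.
  rewrite shift => qu Hg; rewrite free_suffixes_rcons.
  have [Xq|nXq] := pselect (X (rcons q a)).
    exists [::]; first by rewrite mem_rcons mem_head.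
    rewrite /fg_of_word big_nil invg1 mulg1 -[g](mulgVK (fg_of_word (rcons q a))).
    by apply: HM => //; apply: HX.
  exists (rcons q a) => //; rewrite mem_rcons inE mem_filter (map_f (rcons^~ a)) ?andbT //.
  by apply/orP; right; apply/asboolPn.
- have Su : S u by apply: (S_infix Sbu); apply/suffixW/suffix_cons.
  by have [/(_ b Sbu)-> _] := NP u Su uN.
- split; last by exists (free_suffixes u).
  exists [::]; last by rewrite /fg_of_word big_nil invg1 mulg1.
  case/lastP: (u) => [|v a]; first by rewrite mem_head.
  by rewrite free_suffixes_rcons mem_rcons mem_head.
Qed.

(** A word [w] of length [k] receives the value of any of its left extensions; connectedness of its
    extension graph makes this independent of the extension. *)
Lemma coset_system_descent k Om :
  coset_system k.+1 Om -> exists Om', coset_system k Om'.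
Proof.
move=> [OmR OmL OmC].
have /choice[ext extP] : forall w, exists a, S w -> S (a :: w).
  move=> w; have [/S_left[a Sa]|nSw] := pselect (S w); first by exists a.
  have [[a]|nA] := pselect (exists a : A, True); first by exists a.
  by case: nSw; case: w => // a; case: nA; exists a.
pose Om' w := if k < size w then Om w else Om (ext w :: w).
have Om'E w a : size w = k -> S (a :: w) -> Om (a :: w) = Om' w.
  move=> wk Sa; rewrite /Om' wk ltnn.
  have Sw : S w by apply: (S_infix Sa); apply/suffixW/suffix_cons.
  have Se := extP w Sw.
  (* Constant along an edge [a], [b]: both values are [Om (a :: rcons w b)] translated by the
     inverse of [b]. *)
  pose f (x : A + A) : set (freegroup A) := match x with
    | inl a => Om (a :: w)
    | inr b => [set g | Om (rcons w b) (g * fggen b)] end.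
  have conn := S_connected Sw (x := inl a) (y := inl (ext w)) (asboolT Sa) (asboolT Se).
  apply: (@connect_invariant _ _ _ f (inl a) (inl (ext w)) _ conn) => {a Sa conn}.
  have edge a b : S (a :: rcons w b) -> f (inl a) = f (inr b).
    move=> Sab; apply/seteqP.
    have E g : f (inr b) g <-> f (inl a) g.
      rewrite /f /= -(OmL a) ?size_rcons ?wk // -rcons_cons.
      by rewrite (OmR (a :: w)) //= ?wk // mulgK.
    by split=> g /E.
  move=> [a|b] [a'|b'] /and3P[_ _] //= /asboolP; first exact: edge.
  by move=> Sab; apply/esym/edge.
exists Om'; split=> [u a Sua ku g|b u Sbu|u Su].
- have [] := boolP (k < size u) => uk.
    by rewrite /Om' uk size_rcons ltnW // OmR.
  have uk' : size u = k by apply/eqP; rewrite eqn_leq ku leqNgt uk.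
  have [b Sbua] := S_left Sua.
  have Sbu : S (b :: u) by apply: (S_infix Sbua); rewrite -rcons_cons; apply/prefixW/prefix_rcons.
  rewrite -(Om'E u b) // -OmR //= ?uk' //.
  by rewrite OmL ?size_rcons ?uk' // /Om' size_rcons uk' ltnSn.
- rewrite leq_eqVlt => /predU1P[/esym uk|uk]; first by rewrite -(Om'E u b) // /Om' /= uk ltnSn.
  by rewrite /Om' uk /= ltnW // OmL.
- rewrite leq_eqVlt => /predU1P[/esym uk|uk].
    by rewrite -(Om'E u (ext u)) //; last exact: extP; apply: OmC; rewrite /= ?uk //; apply: extP.
  by rewrite /Om' uk; apply: OmC.
Qed.

Lemma finite_index_gen : finite_index H.
Proof.
have [Om [OmR OmL OmC]] : exists Om, coset_system 0 Om.
  have [k] := coset_system_large; elim: k => [//|k IH] [Om OmP].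
  exact/IH/(coset_system_descent OmP).
have [Om1 [s sP]] := OmC _ S_nil (leqnn _).
(* Both rules apply to the one-letter word [a], giving invariance of [Om [::]] under right
   translation by [a]. *)
have gen a g : Om [::] g <-> Om [::] (g * (fggen a)^-1).
  by rewrite -(OmR [::]) //= OmL.
have OmT g : Om [::] g.
  rewrite -[g]fglift_fggen /fglift.
  have : forall h, Om [::] h -> Om [::] (h * \prod_(l <- fgword g) evall (@fggen A) l).
    elim: (fgword g) => [|[a e] w IH] h Oh; first by rewrite big_nil mulg1.
    rewrite big_cons mulgA; apply: IH; rewrite /evall /=; case: e; last by rewrite -gen.
    by apply/(gen a); rewrite mulgK.
  by move=> /(_ 1 Om1); rewrite mul1g.
have [H1 HM HV] := (is_subgroupP H).1 (subgroup_gen_is_subgroup _).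
apply: (@sub_finite_set _ _ [set [set h * fg_of_word q | h in H] | q in [set` s]]).
  move=> _ [g _ <-]; have [q qs Hq] := sP g (OmT g); exists q => //.
  apply/seteqP; split=> _ [h Hh <-].
    exists (h * (fg_of_word q * g^-1)); last by rewrite -!mulgA mulVg mulg1.
    by apply: HM => //; rewrite -[_ * _]invgK invgF; apply: HV.
  exists (h * (g * (fg_of_word q)^-1)); last by rewrite -!mulgA mulVg mulg1.
  exact: HM.
exact/finite_image/finite_seq.
Qed.

End FiniteIndex.

(** * Infinite words, recurrence and compactness *)

Lemma take_mkseq (T : Type) (y : nat -> T) k n :
  take k (mkseq y n) = mkseq y (minn k n).
Proof. by rewrite /mkseq -map_take take_iota. Qed.

Lemma prefix_mkseq (T : eqType) (p : seq T) (y : nat -> T) n :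
  prefix p (mkseq y n) -> p = mkseq y (size p).
Proof.
move=> pn; have := size_prefix pn; rewrite size_mkseq => le_n.
by move: pn; rewrite prefixE => /eqP <-; rewrite take_mkseq size_mkseq (minn_idPl le_n).
Qed.

Section UniformRecurrence.
Local Open Scope classical_set_scope.
Variables (A : finType) (S : set (seq A)).
Implicit Types (u v w : seq A) (y : nat -> A).

Hypothesis S_unif : uniformly_recurrent S.
Hypothesis S_prol : prolongable S.
Hypothesis S_nil : S [::].

Lemma prolongable_size n : exists2 u, S u & n <= size u.
Proof.
elim: n => [|n [u Su nu]]; first by exists [::].
have [v [Sv /prefixP[s vE] uv]] := S_prol Su; exists v => //.
case: s => [|a s] in vE *; first by rewrite cats0 in vE; case: uv.
by rewrite vE size_cat /=; lia.
Qed.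

(** In a long word of [S], [w] occurs after the first letter, hence is preceded by some letter. *)
Lemma recurrent_left w : S w -> exists a, S (a :: w).
Proof.
have [S_infix S_rec] := S_unif => Sw; have [N [_ NP]] := S_rec w Sw.
have [[//|c u] Scu cuN] := prolongable_size N.+1.
have Su : S u by apply: (S_infix _ _ Scu); apply/suffixW/suffix_cons.
have /infixP[p [s uE]] := NP u Su cuN.
have : c :: p != [::] by [].
case/lastP E : (c :: p) => [//|p' a] _; exists a; apply: (S_infix _ _ Scu).
by apply/infixP; exists p', s; rewrite uE -cat_cons E cat_rcons.
Qed.

(** The prefix is searched for in [y] without its first letter, so that the occurrence found ends
    strictly later. *)
Lemma recurrent_prefix y n : (forall n, S (mkseq y n)) ->
  exists2 n', n < n' & suffix (mkseq y n) (mkseq y n').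
Proof.
have [S_infix S_rec] := S_unif => Sy; have [N [_ NP]] := S_rec _ (Sy n).
have mkE : mkseq y N.+1 = y 0 :: mkseq (fun i => y i.+1) N.
  by rewrite /mkseq /= -[1]/(1 + 0) iotaDl -map_comp.
have /infixP[p [s pE]] : infix (mkseq y n) (mkseq (fun i => y i.+1) N).
  apply: NP; last by rewrite size_mkseq.
  by apply: (S_infix _ _ (Sy N.+1)); rewrite mkE; apply/suffixW/suffix_cons.
exists (size p + n).+1; first by rewrite ltnS leq_addl.
have le_N : (size p + n).+1 <= N.+1.
  by have := congr1 size pE; rewrite !size_cat !size_mkseq; lia.
rewrite -(minn_idPl le_N) -take_mkseq mkE pE /= catA take_size_cat.
  exact: (suffix_suffix (y 0 :: p)).
by rewrite size_cat size_mkseq.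
Qed.

Section Codes.
Variable X : set (seq A).

Definition covers := forall y, (forall n, S (mkseq y n)) -> exists n, X (mkseq y n).

(* Koenig's lemma for the tree of the words of S with no prefix in X. *)
Lemma covers_bounded (a0 : A) : covers ->
  exists M, forall u, S u -> M <= size u -> exists2 p, X p & prefix p u.
Proof.
have [S_infix _] := S_unif => cov; apply: contrapT => nM.
pose bad w := forall n, exists u, [/\ S u, n <= size u, prefix w u & X_free X u].
have bad0 : bad [::].
  move=> n; apply: contrapT => nu; apply: nM; exists n => u Su un.
  apply: contrapT => nX; apply: nu; exists u; split; rewrite ?prefix0s //.
  by move=> p pu Xp; apply: nX; exists p.
have /choice[nxt nxtP] : forall w, exists a, bad w -> bad (rcons w a).
  move=> w; have [bw|] := pselect (bad w); last by exists a0.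
  apply: contrapT => nw.
  have /choice[b bP] : forall a, exists n,
      ~ exists u, [/\ S u, n <= size u, prefix (rcons w a) u & X_free X u].
    move=> a; apply: contrapT => na; apply: nw; exists a => _ n.
    by apply: contrapT => nn; apply: na; exists n.
  (* Finiteness of the alphabet gives a common bound for all failing letters; [(size w).+1] ensures
     that [u] has a letter after [w]. *)
  have [u [Su nu wu Xu]] := bw (maxn (size w).+1 (\max_a b a)).
  case/prefixP: wu => [[|a s] uE].
    by move: nu; rewrite uE cats0 geq_max ltnn.
  apply: (bP a); exists u; split=> //; last by rewrite uE -cat_rcons prefix_prefix.
  by apply: leq_trans nu; rewrite leq_max leq_bigmax orbT.
pose branch n := iter n (fun w => rcons w (nxt w)) [::].
have bad_branch n : bad (branch n) by elim: n => //= n; apply: nxtP.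
have branchE n : mkseq (fun i => nxt (branch i)) n = branch n.
  by elim: n => // n IH; rewrite mkseqS IH.
have [n|n] := cov (fun i => nxt (branch i)).
  rewrite branchE; have [u [Su _ wu _]] := bad_branch n 0.
  exact: (S_infix _ _ Su (prefixW wu)).
by rewrite branchE; have [u [_ _ wu Xu]] := bad_branch n 0; apply: Xu.
Qed.

Local Notation H := (subgroup_gen [set fg_of_word u | u in X]).

Hypothesis H_prefix : forall u, S u -> u != [::] -> H (fg_of_word u) ->
  exists2 p, X p & prefix p u.

(** Iterated recurrence gives prefixes of [y], each a suffix of the later ones. Two of them share a
    coset by the pigeonhole principle, and their left quotient [t] is again a prefix of [y]. *)
Lemma finite_index_covers : finite_index H -> covers.
Proof.
move=> finH y Sy.
have /choice[nxt nxtP] : forall n, exists n', n < n' /\ suffix (mkseq y n) (mkseq y n').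
  by move=> n; have [n' ? ?] := recurrent_prefix n Sy; exists n'.
pose nn k := iter k nxt 0.
have nnP j k : j < k -> nn j < nn k /\ suffix (mkseq y (nn j)) (mkseq y (nn k)).
  elim: k => // k IH; rewrite ltnS leq_eqVlt => /predU1P[->|/IH[lt_k suf_k]].
    exact: nxtP.
  have [lt_k' suf_k'] := nxtP (nn k); split; first exact: ltn_trans lt_k lt_k'.
  exact: suffix_trans suf_k suf_k'.
pose coset (g : freegroup A) := [set (h * g)%g | h in H].
have [j [k [jk cjk]]] : exists j k, j < k /\
    coset (fg_of_word (mkseq y (nn j))) = coset (fg_of_word (mkseq y (nn k))).
  pose f k := coset (fg_of_word (mkseq y (nn k))).
  apply: contrapT => njk; have injf : injective f.
    move=> j k fjk; have [jk|kj|//] := ltngtP j k.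
      by case: njk; exists j, k.
    by case: njk; exists k, j.
  have := finite_preimage (in2W injf) finH.
  have -> : f @^-1` range coset = [set: nat].
    by apply/seteqP; split=> // k _; exists (fg_of_word (mkseq y (nn k))).
  exact: infinite_nat.
have [lt_jk /suffixP[t tE]] := nnP j k jk.
have t0 : t != [::].
  apply: contraTneq lt_jk => t0; have := congr1 size tE.
  by rewrite t0 !size_mkseq => ->; rewrite ltnn.
have [H1 _ _] := (is_subgroupP H).1 (subgroup_gen_is_subgroup _).
have Ht : H (fg_of_word t).
  have : coset (fg_of_word (mkseq y (nn k))) (fg_of_word (mkseq y (nn k))).
    by exists 1%g => //; rewrite mul1g.
  by rewrite -cjk tE fg_of_word_cat => -[h Hh] /mulIg <-.
have tpre : prefix t (mkseq y (nn k)) by rewrite tE prefix_prefix.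
have St : S t by rewrite (prefix_mkseq tpre).
have [p Xp pt] := H_prefix St t0 Ht.
by exists (size p); rewrite -(prefix_mkseq (prefix_trans pt tpre)).
Qed.

End Codes.
End UniformRecurrence.

(** * Positions and plays of the strategy tree *)

Section StrategyPositions.
Local Open Scope classical_set_scope.
Variables (A : eqType) (S : set (seq A)) (s : seq A -> A).
Implicit Types (p q u v : seq A) (x y : nat -> A).

Lemma even_seq_ind (P : seq A -> Prop) : P [::] ->
  (forall p a c, ~~ odd (size p) -> P p -> P (p ++ [:: a; c])) ->
  forall p, ~~ odd (size p) -> P p.
Proof.
move=> P0 PS p; have [n] := ubnP (size p); elim: n p => // n IH p.
case/lastP: p => [//|p c]; case/lastP: p => [//|p a].
rewrite !size_rcons /= negbK -!cats1 -catA => sz ev.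
by apply: (PS) => //; apply: IH => //; lia.
Qed.

Lemma hat_cat p q : ~~ odd (size p) -> hat (p ++ q) = hat p ++ hat q.
Proof.
have [n] := ubnP (size p); elim: n p => // n IH [|a [|c p]] //= sz.
by rewrite negbK => ev; rewrite IH //; lia.
Qed.

Lemma size_hat p : size (hat p) = (size p)./2.
Proof.
have [n] := ubnP (size p); elim: n p => // n IH [|a [|c p]] //= sz.
by rewrite IH //; lia.
Qed.

(* The position reached when Player 2 plays u against s. *)
Definition response u := foldl (fun p c => p ++ [:: s p; c]) [::] u.

Lemma response_rcons u c :
  response (rcons u c) = response u ++ [:: s (response u); c].
Proof. by rewrite /response foldl_rcons. Qed.

Lemma size_response u : size (response u) = (size u).*2.
Proof.
by elim/last_ind: u => // u c IH; rewrite response_rcons size_cat IH size_rcons /=; lia.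
Qed.

Lemma odd_size_response u : ~~ odd (size (response u)).
Proof. by rewrite size_response odd_double. Qed.

Lemma hat_response u : hat (response u) = u.
Proof.
elim/last_ind: u => // u c IH.
by rewrite response_rcons hat_cat ?odd_size_response // IH cats1.
Qed.

Lemma take_response u k : k <= size u ->
  take k.*2 (response u) = response (take k u).
Proof.
elim/last_ind: u => [|u c IH]; first by case: k.
rewrite size_rcons leq_eqVlt => /predU1P[->|]; last rewrite ltnS => ku.
  by rewrite !take_oversize ?size_response ?size_rcons.
rewrite response_rcons takel_cat ?size_response ?leq_double // IH //.
by rewrite -cats1 takel_cat.
Qed.

Lemma take_response_odd u k : k < size u ->
  take k.*2.+1 (response u) = rcons (response (take k u)) (s (response (take k u))).
Proof.
move=> ku; have k2 : k.*2.+1 <= k.+1.*2 by rewrite doubleS leqnSn.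
rewrite -(take_takel _ k2) take_response //.
case: u ku => // a u ku; rewrite (take_nth a ku) response_rcons.
rewrite take_cat size_response (size_takel (ltnW ku)) ltnNge leqnSn /= subSnn.
by rewrite /= cats1.
Qed.

Definition played p :=
  forall i, i.*2 < size p -> onth p i.*2 = Some (s (take i.*2 p)).

Lemma played_cat p a c : ~~ odd (size p) ->
  played (p ++ [:: a; c]) <-> played p /\ a = s p.
Proof.
move=> ev; have pE : size p = (size p)./2.*2 by lia.
split=> [pac|[pp ->] i].
  split=> [i ip|].
    have := pac i; rewrite size_cat onth_cat ip takel_cat ?(ltnW ip) //.
    by apply; lia.
  have := pac (size p)./2; rewrite -pE size_cat onth_cat ltnn subnn take_size_cat //=.
  by rewrite addn2 ltnS leqnSn => /(_ isT) [].
rewrite size_cat onth_cat /= => ip; have [lt_ip|le_pi] := ltnP.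
  by rewrite takel_cat ?pp // ltnW.
have -> : i.*2 = size p by lia.
by rewrite subnn take_size_cat.
Qed.

Lemma played_response u : played (response u).
Proof.
elim/last_ind: u => // u c IH; rewrite response_rcons.
by apply/played_cat => //; apply: odd_size_response.
Qed.

Lemma playedE p : ~~ odd (size p) -> played p -> p = response (hat p).
Proof.
move: p; apply: even_seq_ind => // p a c ev IH /(played_cat _ _ ev)[pp ->].
by rewrite hat_cat //= cats1 response_rcons -IH.
Qed.

Local Notation T := (strategy_tree S s).

Lemma strategy_tree_response u : S u -> T (response u).
Proof.
move=> Su; exists (response u); last exact: prefix_refl.
split; [exact: odd_size_response|by rewrite hat_response|exact: played_response].
Qed.

Lemma strategy_tree_prefix p q : T q -> prefix p q -> T p.
Proof. by move=> [r rS qr] /prefix_trans pq; exists r => //; apply: pq. Qed.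

Hypothesis S_prefix : forall u v, S v -> prefix u v -> S u.

(** The moves of Player 2 determine a position, up to one last forced move of Player 1. *)
Lemma strategy_treeP q : T q ->
  S (hat q) /\ q = if odd (size q) then rcons (response (hat q)) (s (response (hat q)))
                   else response (hat q).
Proof.
move=> [p [ev Sp /(playedE ev) pE] qp].
have nu : size q <= (size (hat p)).*2.
  by rewrite -size_response -pE; apply: size_prefix.
move: qp; rewrite prefixE pE => /eqP qE.
move: (size q) (hat p) nu qE Sp => n u nu <- Sp {p pE ev}.
have Su k : S (take k u) by apply: (S_prefix Sp); apply: prefix_take.
have [on|en] := boolP (odd n).
  have nE : n = n./2.*2.+1 by lia.
  rewrite nE take_response_odd; last lia.
  rewrite -cats1 hat_cat ?odd_size_response // hat_response cats0.
  by split; [exact: Su|rewrite cats1].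
have nE : n = n./2.*2 by lia.
by rewrite nE take_response ?hat_response; [split=> //; apply: Su|lia].
Qed.

Lemma strategy_tree_forced u a : T (rcons (response u) a) -> a = s (response u).
Proof.
move=> /strategy_treeP[_]; rewrite size_rcons /= odd_size_response.
by rewrite -cats1 hat_cat ?odd_size_response // hat_response cats0 cats1 => /rcons_inj[].
Qed.

Lemma hat_play x n : plays T x ->
  hat (mkseq x n.*2) = mkseq (fun i => x i.*2.+1) n /\
  mkseq x n.*2 = response (mkseq (fun i => x i.*2.+1) n).
Proof.
move=> xT; have hatE : hat (mkseq x n.*2) = mkseq (fun i => x i.*2.+1) n.
  elim: n => // n IH; rewrite doubleS !mkseqS -!cats1 -catA hat_cat.
    by rewrite IH /= cats1 -mkseqS.
  by rewrite size_mkseq odd_double.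
have [_] := strategy_treeP (xT n.*2).
by rewrite size_mkseq odd_double hatE.
Qed.

(** The infinite analogue of [response]. *)
Definition play_against y n :=
  if odd n then y n./2 else s (response (mkseq y n./2)).

Lemma mkseq_play_against y n : mkseq (play_against y) n.*2 = response (mkseq y n).
Proof.
elim: n => // n IH; rewrite doubleS !mkseqS response_rcons IH -!cats1 -catA /=.
by rewrite /play_against /= odd_double /= doubleK uphalf_double.
Qed.

Hypothesis S_right : forall u, S u -> exists c, S (rcons u c).

Lemma strategy1_tree : strategy1 T s.
Proof.
move=> p Tp ev; have [Sp] := strategy_treeP Tp; rewrite (negPf ev) => pE.
have [c Sc] := S_right Sp; apply: (strategy_tree_prefix (strategy_tree_response Sc)).
by rewrite response_rcons -pE -cat_rcons prefix_prefix.
Qed.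

(** Every strategy in the tree agrees with [s] at the positions of the tree where Player 1 moves, so
    the plays are those of Player 2's infinite words against [s]. *)
Lemma player1_wins_covers (Z : set (seq A)) : Z `<=` T ->
  player1_wins T (\bigcup_(p in Z) plays_from T p) <->
  forall y, (forall n, S (mkseq y n)) -> exists n, [set hat p | p in Z] (mkseq y n).
Proof.
move=> ZT; split=> [[s' [s'T s'W]] y Sy|cov].
  have xT : plays T (play_against y).
    move=> n; apply: (strategy_tree_prefix (strategy_tree_response (Sy n))).
    rewrite -mkseq_play_against prefixE size_mkseq; apply/eqP.
    by rewrite take_mkseq; congr mkseq; lia.
  have [|p Zp [_ pE]] := s'W _ xT.
    move=> n en; have nE : n = n./2.*2 by lia.
    rewrite nE mkseq_play_against {1}/play_against odd_double doubleK.
    apply/esym/strategy_tree_forced/s'T; last exact: odd_size_response.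
    exact: strategy_tree_response.
  exists (size p)./2; exists p => //; rewrite -{1}pE.
  (* When [p] has odd length, its last entry is a forced move, which [hat] drops. *)
  have [|en] := boolP (odd (size p)) => [on|].
    have nE : size p = (size p)./2.*2.+1 by lia.
    rewrite {1}nE mkseqS mkseq_play_against -cats1 hat_cat ?odd_size_response //.
    by rewrite hat_response cats0.
  have nE : size p = (size p)./2.*2 by lia.
  by rewrite {1}nE mkseq_play_against hat_response.
exists s; split=> [|x xT xs]; first exact: strategy1_tree.
have [n|n [p Zp pn]] := cov (fun i => x i.*2.+1).
  by have [<- _] := hat_play n xT; have [] := strategy_treeP (xT n.*2).
exists p => //; split=> //; have [_] := strategy_treeP (ZT _ Zp).
have [_ xE] := hat_play n xT.
have := congr1 size pn; rewrite size_hat size_mkseq pn -xE => sz.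
have [op|ep] := boolP (odd (size p)) => pE.
  have nE : size p = n.*2.+1 by lia.
  by rewrite nE mkseqS pE xs ?odd_double.
by have -> : size p = n.*2 by lia.
Qed.

End StrategyPositions.

(** * Winning strategies and subgroups of finite index *)

Local Open Scope classical_set_scope.

Theorem lemma5p6 (A : finType) (S : set (seq A))
    (S_unif : uniformly_recurrent S) (S_prol : prolongable S)
    (S_tree : tree_set S) (S_alph : forall a : A, S [:: a])
    (s1 : seq A -> A) (s1_strat : strategy1 [set: seq A] s1)
    (Z : set (seq A)) (Z_sub : Z `<=` strategy_tree S s1)
    (Z_bifix : bifix_code [set hat p | p in Z]) :
  let T := strategy_tree S s1 in
  let W := \bigcup_(p in Z) plays_from T p in
  let Zhat : set (freegroup A) := [set fg_of_word (hat p) | p in Z] in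
  (player1_wins T W <->
     exists H : set (freegroup A), finite_index H /\ free_basis Zhat H) /\
  (player1_wins T W -> finite_index (subgroup_gen Zhat)).
Proof.
move=> T W Zhat; set X := [set hat p | p in Z] in Z_bifix.
have [S_infix S_rec] := S_unif.
(* The strategy supplies a letter, so the alphabet is nonempty. *)
have a0 : A := s1 [::].
have S_nil : S [::] by apply: (S_infix _ _ (S_alph a0)); apply: infix0s.
have S_prefix u v : S v -> prefix u v -> S u.
  by move=> Sv /prefixW; apply: S_infix.
have S_left := recurrent_left S_unif S_prol S_nil.
have S_right u : S u -> exists c, S (rcons u c).
  move=> /S_prol[v [Sv /prefixP[[|c r] vE]]]; first by rewrite vE cats0.
  by exists c; apply: (S_prefix _ v) => //; rewrite vE -cat_rcons prefix_prefix.
have S_acyclic w (Sw : S w) := let: And3 _ _ acyclic := S_tree w Sw in acyclic.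
have S_connected w (Sw : S w) := let: And3 _ conn _ := S_tree w Sw in conn.
have ZhatE : Zhat = [set fg_of_word u | u in X].
  apply/seteqP; split=> [_ [p Zp <-]|_ [_ [p Zp <-] <-]]; last by exists p.
  by exists (hat p) => //; exists p.
have X_sub : X `<=` S by move=> _ [p /Z_sub /(strategy_treeP S_prefix)[? _] <-].
have wins : player1_wins T W <-> covers S X.
  exact: player1_wins_covers.
have index_gen : covers S X -> finite_index (subgroup_gen Zhat).
  move=> /(covers_bounded S_unif a0)[M MP]; rewrite ZhatE.
  apply: (@finite_index_gen A S X _ _ _ _ _ _ _ M) => //.
  by move=> w /S_rec[N []]; exists N.
split; last by move=> /wins.
split=> [/wins cov|[H [Hfin [HE _]]]].
  exists (subgroup_gen Zhat); split; first exact: index_gen.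
  split=> //; rewrite ZhatE.
  exact: (@bifix_code_free A S X).
apply/wins/finite_index_covers => //; last by rewrite -ZhatE -HE.
move=> u Su u0; apply: (@subgroup_gen_prefix A S X) => //.
Qed.
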